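(* For all $H\in(1/2,1)$ and all $\alpha\in[0,2H]$, there exists $C_{\alpha,H}\in(0,\infty)$ such that for all $\lambda\in(0,\infty)$, and all $t_1,t_2\ge 0$, one has \[ \mathbb{E}[|\mathcal{Z}^{H,\lambda}(t_2)-\mathcal{Z}^{H,\lambda}(t_1)|^2]\le C_{\alpha,H}\lambda^{\alpha-2H}|t_2-t_1|^\alpha. \]
   Context: $(\beta^H(t))_{t\ge0}$ is a real-valued fractional Brownian motion with Hurst index $H$ (centered Gaussian process with continuous paths and covariance $\frac12(t^{2H}+s^{2H}-|t-s|^{2H})$). For $\phi\in\mathcal{C}^1([0,t])$, $\int_0^t\phi(s)\,d\beta^H(s)=\phi(t)\beta^H(t)-\int_0^t\phi'(s)\beta^H(s)\,ds$. For $\lambda\in(0,\infty)$, the real-valued fractional Ornstein–Uhlenbeck process is $\mathcal{Z}^{H,\lambda}(t)=\int_0^te^{-\lambda(t-s)}\,d\beta^H(s)$, $t\ge0$. Convention: $0^0=1$ when $\alpha=0$. *)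

(* Defs.v *)
From HB Require Import structures.
From mathcomp Require Import all_boot all_order all_algebra.
From mathcomp Require Import all_classical all_reals all_analysis.

Set Implicit Arguments.
Unset Strict Implicit.
Unset Printing Implicit Defensive.

Import Order.TTheory GRing.Theory Num.Theory.
Import numFieldNormedType.Exports.

Local Open Scope classical_set_scope.
Local Open Scope ring_scope.

(* Processes indexed by the half-line [0, +oo) are written X : R -> T -> R
   (time, then outcome); their values at negative times are irrelevant and are
   never constrained below. *)

(* The normal law N(m, s^2), with N(m, 0) the Dirac mass at m. The case
   s = 0 is separated because the library's normal_prob m 0 is by convention
   the uniform law on [0, 1]. *)
Definition gaussian_law (R : realType) (m s : R) : set R -> \bar R :=
  if s == 0 then dirac m else normal_prob m s.

Definition gaussian_rv d (T : measurableType d) (R : realType)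
    (P : probability T R) (X : T -> R) : Prop :=
  exists m s : R, forall A : set R, measurable A ->
    pushforward P X A = gaussian_law m s A.

Definition gaussian_process d (T : measurableType d) (R : realType)
    (P : probability T R) (X : R -> T -> R) : Prop :=
  forall (n : nat) (t a : 'I_n -> R), (forall i, 0 <= t i) ->
    gaussian_rv P (fun w => \sum_(i < n) a i * X (t i) w).

Record fractional_brownian_motion d (T : measurableType d) (R : realType)
    (P : probability T R) (H : R) (B : R -> T -> R) : Prop := {
  fbm_measurable : forall t, 0 <= t -> measurable_fun [set: T] (B t) ;
  fbm_gaussian : gaussian_process P B ;
  fbm_centered : forall t, 0 <= t -> ('E_P[B t] = 0)%E ;
  fbm_covariance : forall s t, 0 <= s -> 0 <= t ->
    covariance P (B s) (B t) =
      (2^-1 * (t `^ (2 * H) + s `^ (2 * H) - `|t - s| `^ (2 * H)))%:E ;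
  fbm_continuous : forall w, {within `[0, +oo[, continuous (fun t => B t w)}
}.

(* The integral of phi against dB over [0, t], for phi of class C^1 on [0, t],
   defined pathwise by integration by parts (B 0 = 0 almost surely). *)
Definition path_integral (T : Type) (R : realType) (B : R -> T -> R)
    (phi : R -> R) (t : R) (w : T) : R :=
  phi t * B t w - \int[lebesgue_measure]_(s in `[0, t]) (derive1 phi s * B s w).

Definition fractional_OU (T : Type) (R : realType) (B : R -> T -> R)
    (lambda t : R) (w : T) : R :=
  path_integral B (fun s => expR (- lambda * (t - s))) t w.

(* Main.v *)
Require Import Defs.
From HB Require Import structures.
From mathcomp Require Import all_boot all_order all_algebra.
From mathcomp Require Import all_classical all_reals all_analysis.
From mathcomp Require Import measurable_realfun.
From mathcomp Require Import ring lra.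
Import Order.TTheory GRing.Theory Num.Theory.
Import numFieldNormedType.Exports.
Local Open Scope classical_set_scope.
Local Open Scope ring_scope.

(** Integrating by parts, a fractional Ornstein-Uhlenbeck path is an average of
increments of the driving path. With
[X s = B (max s 0) - B 0] and the exponential weight [q] of rate [lambda] cut
off at some [b >= t],

  [Z t = X t - int q(u) X(t - u) du + exp(- lambda t) B 0],

where [q >= 0] has mass at most 1 and [B 0 = 0] almost surely
([fractional_OUE]). No covariance of [Z] has to be computed: as the second
moments of the increments of [X] are at most [|t - s| ^ (2 H)], two
applications of Jensen's inequality and of Tonelli's theorem
([mean_square_le_average]) are enough.

- Uniform bound. Taking [b = t], [Z t] is the sum of [exp(- lambda t) X t], of the
  average of [X t - X (t - u)] and of a null term. The average has second moment
  at most [int q(u) u ^ (2 H) du], and both this integral and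
  [exp(- 2 lambda t) t ^ (2 H)] are of order at most [lambda ^ (- 2 H)]
  ([fractional_OU_mean_square]).
- Increment bound. Taking the same cutoff [b = t2] for both times, [Z t2 - Z t1]
  is the difference of [X t2 - X t1] and of the average of
  [X (t2 - u) - X (t1 - u)], all of second moment at most
  [|t2 - t1| ^ (2 H)] ([fractional_OU_increment_mean_square]).

The minimum of [lambda ^ (- 2 H)] and [h ^ (2 H)] is at most
[lambda ^ (alpha - 2 H) * h ^ alpha] for [0 <= alpha <= 2 H]
([powR_interpolation]), which gives the theorem. The constant obtained does not
depend on [alpha] and [H]. *)

Set Implicit Arguments.
Unset Strict Implicit.
Unset Printing Implicit Defensive.

(** * Joint measurability of continuous processes *)

Lemma cvg_floor_grid (R : realType) (t : R) :
  ((Num.floor (n.+1%:R * t))%:~R / n.+1%:R) @[n --> \oo] --> t.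
Proof.
apply/cvgrPdist_le => /= e e0.
near=> n.
have n0 : (0 < n.+1%:R :> R) by rewrite ltr0n.
have -> : t - (Num.floor (n.+1%:R * t))%:~R / n.+1%:R =
   (n.+1%:R * t - (Num.floor (n.+1%:R * t))%:~R) / n.+1%:R.
  by rewrite mulrBl mulrAC divff ?mul1r ?gt_eqF.
rewrite normrM normfV (gtr0_norm n0) ger0_norm ?subr_ge0 ?floor_le//.
apply: (@le_trans _ _ n.+1%:R^-1).
  rewrite ler_pdivrMr// mulVf ?gt_eqF//.
  rewrite lerBlDr; apply: ltW.
  by have := floorD1_gt (n.+1%:R * t); rewrite intrD addrC.
apply: ltW; near: n; exact: (near_infty_natSinv_lt (PosNum e0)).
Unshelve. all: by end_near. Qed.

Lemma measurable_fun_grid d (T : measurableType d) (R : realType)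
    (X : R -> T -> R) (n : nat) :
  (forall t, measurable_fun [set: T] (X t)) ->
  measurable_fun [set: measurableTypeR R * T]
    (fun z : measurableTypeR R * T =>
       X ((Num.floor (n.+1%:R * z.1))%:~R / n.+1%:R) z.2).
Proof.
move=> mX _ A mA; rewrite setTI.
rewrite (_ : _ @^-1` A = \bigcup_(k : int)
  ((fun s : R => Num.floor (n.+1%:R * s)) @^-1` [set k]
     `*` (X (k%:~R / n.+1%:R) @^-1` A))); last first.
  by apply/seteqP; split=> [[s w] Asw|[s w] [k _ [/= <-]]]//=; exists (Num.floor (n.+1%:R * s)).
apply: countable_bigcupT_measurable => [|k]; first exact: countableP.
apply: measurableX; last by rewrite -[X in measurable X]setTI; exact: mX.
rewrite (_ : _ @^-1` _ = `[k%:~R / n.+1%:R, (k + 1)%:~R / n.+1%:R[%classic).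
  exact: measurable_itv.
apply/seteqP; split => s /=; rewrite in_itv/= ler_pdivrMr ?ltr0n// ltr_pdivlMr ?ltr0n//.
  by move/eqP; rewrite floor_eq (mulrC s).
by move=> ?; apply/eqP; rewrite floor_eq (mulrC _ s).
Qed.

(** The process is the pointwise limit of the processes sampled at the last point of
the grid of mesh [1 / n.+1], which are piecewise constant in time. *)
Lemma measurable_continuous_process d (T : measurableType d) (R : realType)
    (X : R -> T -> R) :
  (forall t, measurable_fun [set: T] (X t)) ->
  (forall w, continuous (X ^~ w)) ->
  measurable_fun [set: measurableTypeR R * T]
    (fun z : measurableTypeR R * T => X z.1 z.2).
Proof.
move=> mX cX.
apply: (@measurable_fun_cvg _ _ _ _ (fun n (z : measurableTypeR R * T) =>
    X ((Num.floor (n.+1%:R * z.1))%:~R / n.+1%:R) z.2)).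
  by move=> n; exact: measurable_fun_grid.
move=> [s w] _ /=.
apply: (@continuous_cvg _ _ _ _ _ _ (X ^~ w)); first exact: cX.
exact: cvg_floor_grid.
Qed.

(** * Second moments of averages *)

(** The integral of a nonnegative function is a supremum over the simple functions
below it, so monotonicity requires no measurability. *)
Lemma ge0_le_integral_nomeas d (T : measurableType d) (R : realType)
    (mu : {measure set T -> \bar R}) (f g : T -> \bar R) :
  (forall x, 0 <= f x)%E -> (forall x, f x <= g x)%E ->
  (\int[mu]_x f x <= \int[mu]_x g x)%E.
Proof.
move=> f0 fg; have g0 x : (0 <= g x)%E by exact: le_trans (fg x).
rewrite !ge0_integralTE//; apply: le_ereal_sup => _ [h hf <-].
by exists h => // x; exact: le_trans (fg x).
Qed.

(** Jensen's inequality for the square and a weight of mass at most 1. With [a] the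
integral of [q f], it follows by integrating [0 <= q (a - f) ^ 2]. *)
Lemma sqr_Rintegral_le d (S : measurableType d) (R : realType)
    (mu : {measure set S -> \bar R}) (q f : S -> R) :
  (forall u, 0 <= q u) -> measurable_fun setT q -> measurable_fun setT f ->
  (\int[mu]_u (q u)%:E <= 1)%E ->
  mu.-integrable setT (EFin \o (fun u => q u * f u)) ->
  ((((\int[mu]_u (q u * f u)) ^+ 2)%R)%:E <= \int[mu]_u (q u * f u ^+ 2)%:E)%E.
Proof.
move=> q0 mq mf q1 iqf; set a := Rintegral _ _ _.
have mqf2 : measurable_fun setT (fun u => q u * f u ^+ 2).
  by apply: measurable_funM => //; exact: measurable_funX.
have qf20 u : (0 <= (q u * f u ^+ 2)%:E)%E by rewrite lee_fin mulr_ge0// sqr_ge0.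
have [->|qf2oo] := eqVneq (\int[mu]_u (q u * f u ^+ 2)%:E)%E +oo%E.
  by rewrite leey.
have iq : mu.-integrable setT (EFin \o q).
  apply/integrableP; split; first exact/measurable_EFinP.
  under eq_integral do rewrite gee0_abs ?lee_fin//.
  exact: le_lt_trans q1 (ltry 1).
have iqf2 : mu.-integrable setT (EFin \o (fun u => q u * f u ^+ 2)).
  apply/integrableP; split; first exact/measurable_EFinP.
  rewrite (eq_integral (fun u => (q u * f u ^+ 2)%:E)) ?ltey// => u _.
  exact: (gee0_abs (qf20 u)).
have iaq : mu.-integrable setT (EFin \o (fun u => a ^+ 2 * q u)).
  exact: (integrableZl measurableT (a ^+ 2) iq).
have i2a : mu.-integrable setT (EFin \o (fun u => 2 * a * (q u * f u))).
  exact: (integrableZl measurableT (2 * a) iqf).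
have iR : mu.-integrable setT (EFin \o (fun u => a ^+ 2 * q u + q u * f u ^+ 2)).
  exact: (integrableD measurableT iaq iqf2).
have : \int[mu]_u (2 * a * (q u * f u)) <=
    \int[mu]_u (a ^+ 2 * q u + q u * f u ^+ 2).
  apply: le_Rintegral => // u _.
  rewrite -subr_ge0 (_ : _ - _ = q u * (a - f u) ^+ 2); last by ring.
  by rewrite mulr_ge0// sqr_ge0.
rewrite RintegralZl// RintegralD// RintegralZl//.
rewrite -/a => h.
have q1' : \int[mu]_u q u <= 1.
  rewrite -lee_fin /Rintegral fineK//.
  exact: integral_fune_fin_num iq.
rewrite -(@fineK _ (\int[mu]_u (q u * f u ^+ 2)%:E)%E); last first.
  exact: integral_fune_fin_num iqf2.
rewrite lee_fin.
have : a ^+ 2 * \int[mu]_u q u <= a ^+ 2 by rewrite ler_piMr ?sqr_ge0.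
move: h; rewrite /Rintegral.
set I := fine _; set J := fine _ => h1 h2; nra.
Qed.

(** The measurable majorant [g] makes this an upper second moment: pathwise
integrals can be handled without proving that they are measurable in the
outcome. *)
Definition mean_square_le d (T : measurableType d) (R : realType)
    (P : probability T R) (f : T -> R) (K : R) : Prop :=
  exists g : T -> \bar R, [/\ measurable_fun setT g,
    forall w, (((f w) ^+ 2)%:E <= g w)%E & (\int[P]_w g w <= K%:E)%E].

Section mean_square_le.
Context d (T : measurableType d) (R : realType) (P : probability T R).

Lemma expectation_sqr_distC (f g : T -> R) :
  ('E_P[fun w => (`|f w - g w| ^+ 2)%R] = 'E_P[fun w => (`|g w - f w| ^+ 2)%R])%E.
Proof. by congr expectation; apply/funext => w; rewrite distrC. Qed.

Lemma expectation_mean_square_le (f : T -> R) (K : R) :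
  mean_square_le P f K -> ('E_P[fun w => (`|f w| ^+ 2)%R] <= K%:E)%E.
Proof.
move=> [g [_ fg gK]]; rewrite unlock; apply: le_trans gK.
apply: ge0_le_integral_nomeas => w; last by rewrite real_normK ?num_real.
by rewrite lee_fin exprn_ge0.
Qed.

Lemma mean_square_leW (f : T -> R) (K L : R) :
  K <= L -> mean_square_le P f K -> mean_square_le P f L.
Proof.
by move=> KL [g [mg fg gK]]; exists g; split => //; rewrite (le_trans gK)// lee_fin.
Qed.

Lemma mean_square_le_measurable (f : T -> R) (K : R) :
  measurable_fun setT f -> ('E_P[fun w => (f w ^+ 2)%R] <= K%:E)%E ->
  mean_square_le P f K.
Proof.
move=> mf; rewrite unlock => fK; exists (fun w => (f w ^+ 2)%:E); split => //.
by apply/measurable_EFinP; exact: measurable_funX.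
Qed.

Lemma mean_square_leZ (c : R) (f : T -> R) (K : R) :
  mean_square_le P f K -> mean_square_le P (fun w => c * f w) (c ^+ 2 * K).
Proof.
move=> [g [mg fg gK]]; exists (fun w => (c ^+ 2)%:E * g w)%E; split.
- exact: measurable_funeM.
- by move=> w; rewrite exprMn EFinM lee_wpmul2l// lee_fin sqr_ge0.
- rewrite ge0_integralZl//; last 2 first.
  + by move=> w _; rewrite (le_trans _ (fg w))// lee_fin sqr_ge0.
  + by rewrite lee_fin sqr_ge0.
  by rewrite (EFinM (c ^+ 2)) lee_wpmul2l// lee_fin sqr_ge0.
Qed.

Lemma mean_square_leD (f1 f2 : T -> R) (K1 K2 : R) :
  mean_square_le P f1 K1 -> mean_square_le P f2 K2 ->
  mean_square_le P (fun w => f1 w + f2 w) (2 * (K1 + K2)).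
Proof.
move=> [g1 [mg1 fg1 gK1]] [g2 [mg2 fg2 gK2]].
have g10 w : (0 <= g1 w)%E by rewrite (le_trans _ (fg1 w))// lee_fin sqr_ge0.
have g20 w : (0 <= g2 w)%E by rewrite (le_trans _ (fg2 w))// lee_fin sqr_ge0.
exists (fun w => 2%:E * (g1 w + g2 w))%E; split.
- by apply: measurable_funeM; exact: emeasurable_funD.
- move=> w; apply: (@le_trans _ _ (2%:E * ((f1 w ^+ 2)%:E + (f2 w ^+ 2)%:E))%E).
    rewrite -EFinD -EFinM lee_fin -subr_ge0.
    by rewrite (_ : _ - _ = (f1 w - f2 w) ^+ 2) ?sqr_ge0//; ring.
  by rewrite lee_wpmul2l ?leeD// lee_fin.
- rewrite ge0_integralZl//; last 2 first.
  + exact: emeasurable_funD.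
  + by move=> w _; rewrite adde_ge0.
  by rewrite ge0_integralD// EFinM (EFinD K1) lee_wpmul2l ?leeD.
Qed.

(** Jensen's inequality for each outcome, then Tonelli's theorem. *)
Lemma mean_square_le_average d' (S : measurableType d')
    (mu : {sigma_finite_measure set S -> \bar R})
    (q v : S -> R) (Y : S -> T -> R) (K : R) :
  (forall u, 0 <= q u) -> measurable_fun setT q ->
  (\int[mu]_u (q u)%:E <= 1)%E ->
  measurable_fun [set: S * T] (fun z => Y z.1 z.2) ->
  (forall w, mu.-integrable setT (EFin \o (fun u => q u * Y u w))) ->
  (forall u, (0 < q u)%R -> 'E_P[fun w => (Y u w ^+ 2)%R] <= (v u)%:E)%E ->
  measurable_fun setT v -> (\int[mu]_u (q u * v u)%:E <= K%:E)%E ->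
  mean_square_le P (fun w => \int[mu]_u (q u * Y u w)) K.
Proof.
move=> q0 mq q1 mY iqY Yv mv qvK.
pose F (z : S * T) : \bar R := (q z.1 * Y z.1 z.2 ^+ 2)%:E.
have mF : measurable_fun setT F.
  apply/measurable_EFinP; apply: measurable_funM; last exact: measurable_funX.
  exact: measurableT_comp.
have F0 z : (0 <= F z)%E by rewrite lee_fin mulr_ge0// sqr_ge0.
exists (fun w => \int[mu]_u F (u, w))%E; split.
- exact: (measurable_fun_fubini_tonelli_G F mF F0).
- move=> w; apply: sqr_Rintegral_le => //.
  exact: (measurableT_comp mY (pair2_measurable w)).
- rewrite -(fubini_tonelli F)//; apply: le_trans qvK.
  apply: ge0_le_integral => //.
  + by move=> u _; apply: integral_ge0.
  + exact: (measurable_fun_fubini_tonelli_F F mF F0).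
  + by apply/measurable_EFinP; exact: measurable_funM.
  + move=> u _; rewrite /F /=.
    under eq_integral do rewrite EFinM.
    rewrite ge0_integralZl//; last 3 first.
    * apply/measurable_EFinP/measurable_funX.
      exact: (measurableT_comp mY (pair1_measurable u)).
    * by move=> w _; rewrite lee_fin sqr_ge0.
    * by rewrite lee_fin.
    have := q0 u; rewrite le_eqVlt => /predU1P[<-|qu0]; first by rewrite !mul0e mul0r.
    rewrite EFinM lee_wpmul2l ?lee_fin//.
    by have := Yv u qu0; rewrite unlock.
Qed.

End mean_square_le.

(** * Increments of fractional Brownian motion *)

Lemma fbm_second_moment d (T : measurableType d) (R : realType)
    (P : probability T R) (H : R) (B : R -> T -> R) (t : R) :
  0 < H -> fractional_brownian_motion P H B -> 0 <= t ->
  ('E_P[fun w => (B t w ^+ 2)%R] = (t `^ (2 * H))%:E)%E.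
Proof.
move=> H0 fB t0; have := fbm_covariance fB t0 t0.
rewrite unlock (fbm_centered fB t0) /= subrr normr0 powR0; last by rewrite mulf_neq0// gt_eqF.
have half (x : R) : 2^-1 * (x + x - 0) = x by field.
rewrite half => <-.
by congr expectation; apply/funext => w; rewrite !fctE/= subr0 expr2.
Qed.

Lemma fbm_Lfun2 d (T : measurableType d) (R : realType)
    (P : probability T R) (H : R) (B : R -> T -> R) (t : R) :
  0 < H -> fractional_brownian_motion P H B -> 0 <= t ->
  B t \in Lfun P 2%:E.
Proof.
move=> H0 fB t0; rewrite inE; apply/andP; split; rewrite inE/=.
  exact: fbm_measurable fB t t0.
rewrite /finite_norm unlock/=.
apply: poweR_lty.
have Bt2 := fbm_second_moment H0 fB t0; rewrite unlock in Bt2.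
rewrite (eq_integral (fun w => (B t w ^+ 2)%:E)) => [|w _]; first by rewrite Bt2 ltry.
by rewrite /= powR_mulrn// real_normK ?num_real.
Qed.

Lemma fbm_increment_second_moment d (T : measurableType d) (R : realType)
    (P : probability T R) (H : R) (B : R -> T -> R) (s t : R) :
  0 < H -> fractional_brownian_motion P H B -> 0 <= s -> 0 <= t ->
  ('E_P[fun w => ((B t w - B s w) ^+ 2)%R] = (`|t - s|%R `^ (2 * H))%:E)%E.
Proof.
move=> H0 fB s0 t0.
have Pfin : P setT \is a fin_num by exact: fin_num_measure.
have Lt := fbm_Lfun2 H0 fB t0; have Ls := fbm_Lfun2 H0 fB s0.
have H2 : 2 * H != 0 by rewrite mulf_neq0// gt_eqF.
have Ets : ('E_P[(B t \- B s)%R] = 0)%E.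
  by rewrite expectationB ?Lfun_subset12// !(fbm_centered fB)// sube0.
have := varianceB Lt Ls; rewrite /variance.
rewrite !(fbm_covariance fB)// !subrr normr0 powR0// !subr0.
rewrite [in LHS]covariance.unlock Ets/= => VE.
transitivity ('E_P[(B t \- B s \- cst 0)%R * (B t \- B s \- cst 0)%R])%E.
  by congr expectation; apply/funext => w; rewrite !fctE/= subr0 expr2.
by rewrite VE -EFinD distrC; congr EFin; field.
Qed.

(** * Continuous functions and exponential weights *)

Lemma ler_dist_max0 (R : realType) (x y : R) :
  `|Num.max x 0 - Num.max y 0| <= `|x - y|.
Proof.
have [x0|x0] := leP x 0; have [y0|y0] := leP y 0.
- by rewrite subrr normr0.
- by rewrite sub0r normrN gtr0_norm// ler0_norm; lra.
- by rewrite subr0 gtr0_norm// gtr0_norm; lra.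
- by [].
Qed.

Lemma continuous_comp_max0 (R : realType) (f : R -> R) :
  {within `[0, +oo[, continuous f} ->
  continuous (fun s : R => f (Num.max s (0 : R))).
Proof.
move=> /subspace_continuousP cf x.
have D0 y : `[0, +oo[%classic (Num.max y (0 : R)).
  by rewrite /= in_itv/= andbT le_max lexx orbT.
apply: (@cvg_comp _ _ _ (fun s : R => Num.max s 0) f _ _ _ _ (cf _ (D0 x))).
move=> A [/= e e0 eA]; exists e => //= y xy; apply: eA (D0 y).
exact: le_lt_trans (ler_dist_max0 x y) xy.
Qed.

Lemma Rintegral_reflection (R : realType) (G : R -> R) (t : R) :
  0 <= t -> continuous G ->
  \int[lebesgue_measure]_(s in `[0, t]) G s =
  \int[lebesgue_measure]_(u in `[0, t]) G (t - u).
Proof.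
move=> t0 cG; congr fine.
have := @integration_by_substitution_decreasing R (fun u => t - u) G 0 t t0.
have dF : derive1 (fun u : R => t - u) = cst (-1).
  by apply/funext => z; rewrite derive1E deriveB// derive_cst derive_id sub0r.
rewrite subrr subr0 => -> //.
- by apply: eq_integral => u _; rewrite dF !fctE opprK mulr1.
- by move=> x y _ _ xy; rewrite ltrD2l ltrN2.
- by rewrite dF => ? _; exact: cvg_cst.
- by rewrite dF; exact: is_cvg_cst.
- by rewrite dF; exact: is_cvg_cst.
- have cF : continuous (fun u : R => t - u).
    by move=> x; apply: continuousB => //; exact: cvg_cst.
  split => /=.
  + by move=> x _; exact: derivableB.
  + exact/cvg_at_right_filter/cF.
  + exact/cvg_at_left_filter/cF.
- exact: continuous_subspaceT.
Qed.

Lemma is_derive_expR_affine (R : realType) (a b x : R) :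
  is_derive x 1 (fun y : R => expR (a * y + b)) (a * expR (a * x + b)).
Proof.
have dg : is_derive x 1 (fun y : R => a * y + b) a.
  have := is_deriveD (is_deriveZ a (is_derive_id x 1)) (is_derive_cst b x 1).
  by move=> /is_derive_eq; apply; rewrite addr0 /GRing.scale/= mulr1.
have := @is_derive1_comp _ expR (fun y : R => a * y + b) x _ _
  (is_derive_expR (a * x + b)) dg.
by rewrite mulrC.
Qed.

Lemma continuous_expR_affine (R : realType) (a b : R) :
  continuous (fun y : R => expR (a * y + b)).
Proof.
move=> y; apply: differentiable_continuous; apply/derivable1_diffP.
by case: (is_derive_expR_affine a b y).
Qed.

Lemma continuous_expR_linear (R : realType) (a : R) :
  continuous (fun y : R => expR (a * y)).
Proof. by have := @continuous_expR_affine R a 0; under eq_fun do rewrite addr0. Qed.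

(** The density of the exponential law of rate [lambda], cut off at [b] so that the
product with any continuous function is integrable. *)
Definition exp_weight (R : realType) (lambda b : R) : R -> R :=
  (fun u => lambda * expR (- lambda * u)) \_ `[0, b].

Section exp_weight.
Context (R : realType) (lambda : R).
Hypothesis lambda0 : 0 < lambda.

Let p u := lambda * expR (- lambda * u).

Let cp : continuous p.
Proof.
by move=> u; apply: cvgM; [exact: cvg_cst|exact: continuous_expR_linear].
Qed.

Lemma exp_weight_ge0 (b u : R) : 0 <= exp_weight lambda b u.
Proof.
rewrite /exp_weight patchE; case: ifP => // _.
by rewrite mulr_ge0 ?expR_ge0// ltW.
Qed.

Lemma exp_weight_gt0 (b u : R) : 0 < exp_weight lambda b u -> 0 <= u <= b.
Proof.
rewrite /exp_weight patchE; case: ifPn => [|_]; first by rewrite inE/= in_itv.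
by rewrite ltxx.
Qed.

Lemma measurable_exp_weight (b : R) : measurable_fun setT (exp_weight lambda b).
Proof.
have mI : measurable (`[0, b]%classic : set R) by exact: measurable_itv.
apply/(measurable_restrictT p mI).
apply: measurable_funTS; apply: continuous_measurable_fun; exact: cp.
Qed.

Lemma exp_weightM (b : R) (f : R -> R) :
  (fun u => exp_weight lambda b u * f u) = (fun u => p u * f u) \_ `[0, b].
Proof.
by apply/funext => u; rewrite /exp_weight !patchE; case: ifP; rewrite ?mul0r.
Qed.

Lemma integrable_exp_weightM (b : R) (f : R -> R) : continuous f ->
  lebesgue_measure.-integrable setT (EFin \o (fun u => exp_weight lambda b u * f u)).
Proof.
move=> cf; rewrite exp_weightM.
have mI : measurable (`[0, b]%classic : set R) by exact: measurable_itv.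
have := (integrable_mkcond (mu := lebesgue_measure) (EFin \o (fun u => p u * f u)) mI).1.
rewrite restrict_EFin; apply.
apply: continuous_compact_integrable; first exact: segment_compact.
apply: continuous_subspaceT => u; apply: cvgM; [exact: cp|exact: cf].
Qed.

Lemma integral_exp_weight (b : R) : 0 <= b ->
  (\int[lebesgue_measure]_u (exp_weight lambda b u)%:E =
   (1 - expR (- lambda * b))%:E)%E.
Proof.
move=> b0; pose F (u : R) := - expR (- lambda * u).
have dF (u : R) : is_derive u 1 F (p u).
  have := is_deriveN (is_derive_expR_affine (- lambda) 0 u).
  by rewrite addr0 mulNr opprK; under eq_fun do rewrite addr0.
have -> : (\int[lebesgue_measure]_u (exp_weight lambda b u)%:E =
    \int[lebesgue_measure]_(u in `[0%R, b]) (p u)%:E)%E.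
  rewrite [RHS]integral_mkcond; apply: eq_integral => u _.
  by rewrite /exp_weight !patchE; case: ifP.
move: b0; rewrite le_eqVlt => /predU1P[<-|b0].
  by rewrite set_itv1 integral_set1 mulr0 expR0 subrr.
have cF : continuous F.
  by move=> u; apply: differentiable_continuous; apply/derivable1_diffP; case: (dF u).
rewrite (@continuous_FTC2 _ p F 0 b)//.
- by rewrite /F mulr0 expR0 -EFinB opprK addrC.
- exact: continuous_subspaceT.
- split => /=.
  + by move=> u _; case: (dF u).
  + exact/cvg_at_right_filter/cF.
  + exact/cvg_at_left_filter/cF.
- by move=> u _; rewrite derive1E; case: (dF u).
Qed.

Lemma integral_exp_weight_le1 (b : R) : 0 <= b ->
  (\int[lebesgue_measure]_u (exp_weight lambda b u)%:E <= 1)%E.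
Proof.
by move=> b0; rewrite integral_exp_weight// lee_fin lerBlDr lerDl expR_ge0.
Qed.

End exp_weight.

(** Multiplying the weight by [expR (lambda / 2 * u)] gives twice the weight of
rate [lambda / 2]. *)
Lemma integral_exp_weight_expR_half (R : realType) (lambda b : R) :
  0 < lambda -> 0 <= b ->
  (\int[lebesgue_measure]_u
     (exp_weight lambda b u * expR (lambda / 2 * u))%:E <= 2%:E)%E.
Proof.
move=> l0 b0; have l20 : 0 < lambda / 2 by rewrite divr_gt0.
under eq_integral => u _.
  have -> : exp_weight lambda b u * expR (lambda / 2 * u) =
      2 * exp_weight (lambda / 2) b u.
    rewrite /exp_weight !patchE; case: ifP => _; last by rewrite mul0r mulr0.
    rewrite -mulrA -expRD (_ : - lambda * u + _ = - (lambda / 2) * u); last by field.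
    by field.
  rewrite EFinM; over.
rewrite ge0_integralZl//=.
- by rewrite -[leRHS]mule1 lee_wpmul2l// integral_exp_weight_le1.
- by apply/measurable_EFinP; exact: measurable_exp_weight.
- by move=> u _; rewrite lee_fin exp_weight_ge0.
Qed.

(** With [y = lambda * x], one has [y ^ a <= 1 + y ^ 2] and
[1 + y ^ 2 / 8 <= expR (y / 2)]. The point is the scaling in [lambda], and a
growth rate that the exponential weight still dominates. *)
Lemma powR_le_expR_half (R : realType) (lambda x a : R) :
  0 < lambda -> 0 <= x -> 0 <= a <= 2 ->
  x `^ a <= lambda `^ (- a) * (8 * expR (lambda / 2 * x)).
Proof.
move=> l0 x0 /andP[a0 a2].
have y0 : 0 <= lambda * x by rewrite mulr_ge0// ltW.
have -> : x `^ a = lambda `^ (- a) * (lambda * x) `^ a.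
  rewrite powRM// ?ltW// mulrA -powRD; last by rewrite lt0r_neq0 ?implybT.
  by rewrite addNr powRr0 mul1r.
rewrite ler_wpM2l ?powR_ge0//.
have h1 : (lambda * x) `^ a <= 1 + (lambda * x) ^+ 2.
  have [y1|y1] := leP (lambda * x) 1.
    apply: (@le_trans _ _ (1 `^ a)); first by rewrite ge0_ler_powR ?nnegrE.
    by rewrite powR1 lerDl sqr_ge0.
  apply: (@le_trans _ _ ((lambda * x) `^ 2)); first by rewrite ler_powR// ltW.
  by rewrite powR_mulrn// lerDr.
have : 1 + (lambda / 2 * x) ^+ 2 / 2 <= expR (lambda / 2 * x).
  by apply: expR_ge1Dxn; rewrite mulrAC divr_ge0.
have := sqr_ge0 (lambda * x).
set e := expR _; have -> : (lambda / 2 * x) ^+ 2 = (lambda * x) ^+ 2 / 4 by field.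
by move: h1; set z := (_ ^+ 2) => ? ? ?; lra.
Qed.

(** * Ornstein-Uhlenbeck paths as averages of increments *)

(** Subtracting [B 0], which vanishes only almost surely, makes every path
continuous on the whole line once it is extended by 0 to negative times. *)
Definition increment_path (T : Type) (R : realType) (B : R -> T -> R)
    (s : R) (w : T) : R :=
  B (Num.max s 0) w - B 0 w.

Lemma increment_pathE (T : Type) (R : realType) (B : R -> T -> R)
    (s : R) (w : T) : 0 <= s -> B s w = increment_path B s w + B 0 w.
Proof. by move=> s0; rewrite /increment_path max_l// subrK. Qed.

Lemma increment_path_le0 (T : Type) (R : realType) (B : R -> T -> R)
    (s : R) (w : T) : s <= 0 -> increment_path B s w = 0.
Proof. by move=> s0; rewrite /increment_path max_r// subrr. Qed.

Lemma continuous_increment_path (T : Type) (R : realType) (B : R -> T -> R)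
    (w : T) : {within `[0, +oo[, continuous (B ^~ w)} ->
  continuous (increment_path B ^~ w).
Proof.
move=> cB s; apply: cvgB; last exact: cvg_cst.
exact: (continuous_comp_max0 cB).
Qed.

(** The cutoff [b] is free because [X (t - u) = 0] for [u >= t]; a common cutoff is
what allows the formulas at two different times to be subtracted. *)
Lemma fractional_OUE (T : Type) (R : realType) (B : R -> T -> R)
    (lambda t b : R) (w : T) : 0 < lambda -> 0 <= t <= b ->
  {within `[0, +oo[, continuous (B ^~ w)} ->
  fractional_OU B lambda t w =
    increment_path B t w
      - \int[lebesgue_measure]_u
          (exp_weight lambda b u * increment_path B (t - u) w)
      + expR (- lambda * t) * B 0 w.
Proof.
move=> l0 /andP[t0 tb] cB; pose X := increment_path B ^~ w.
have cX : continuous X by exact: continuous_increment_path.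
have cXr : continuous (fun u => X (t - u)).
  move=> u; apply: (@continuous_comp _ _ _ (fun u => t - u) X); last exact: cX.
  by apply: cvgB; [exact: cvg_cst|].
have dphi s : derive1 (fun s => expR (- lambda * (t - s))) s =
    lambda * expR (- lambda * (t - s)).
  have d1 := is_derive_expR_affine lambda (- lambda * t) s.
  rewrite (_ : (fun _ => _) = (fun s => expR (lambda * s + - lambda * t))); last first.
    by apply/funext => v; congr expR; ring.
  rewrite derive1E; case: d1 => _ ->; congr (_ * expR _); ring.
have cG : continuous (fun s => lambda * expR (- lambda * (t - s)) * (X s + B 0 w)).
  move=> s; apply: cvgM; last by apply: cvgD; [exact: cX|exact: cvg_cst].
  apply: cvgM; first exact: cvg_cst.
  rewrite (_ : (fun _ => _) = (fun s => expR (lambda * s + - lambda * t))); last first.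
    by apply/funext => v; congr expR; ring.
  rewrite (_ : - lambda * (t - s) = lambda * s + - lambda * t); last by ring.
  exact: continuous_expR_affine.
rewrite /fractional_OU /path_integral subrr mulr0 expR0 mul1r.
rewrite (increment_pathE B w t0).
under eq_Rintegral.
  move=> s; rewrite inE/= in_itv/= => /andP[s0 _].
  rewrite dphi (increment_pathE B w s0); over.
rewrite /= Rintegral_reflection//.
transitivity (X t + B 0 w - \int[lebesgue_measure]_u
    (exp_weight lambda t u * X (t - u) + B 0 w * exp_weight lambda t u)).
  congr (_ - _); rewrite [LHS]Rintegral_mkcond; apply: eq_Rintegral => u _.
  rewrite /exp_weight !patchE; case: ifP => _; last by rewrite mul0r mulr0 addr0.
  by rewrite subKr /X; ring.
have iX : lebesgue_measure.-integrable setT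
    (EFin \o (fun u => exp_weight lambda t u * X (t - u))).
  exact: integrable_exp_weightM.
have iq : lebesgue_measure.-integrable setT (EFin \o (exp_weight lambda t)).
  have -> : exp_weight lambda t = (fun u => exp_weight lambda t u * 1).
    by apply/funext => u; rewrite mulr1.
  by apply: (@integrable_exp_weightM _ lambda t (cst 1)) => u; exact: cvg_cst.
rewrite RintegralD//; last exact: (integrableZl measurableT (B 0 w) iq).
rewrite RintegralZl// [X in _ - (_ + _ * X)]/Rintegral integral_exp_weight//=.
(* the integrand vanishes on ]t, b] *)
have -> : \int[lebesgue_measure]_u (exp_weight lambda t u * X (t - u)) =
   \int[lebesgue_measure]_u (exp_weight lambda b u * X (t - u)).
  apply: eq_Rintegral => u _; rewrite /exp_weight !patchE.
  case: ifPn => [|/negP]; rewrite inE/= in_itv/=.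
    move=> /andP[u0 ut]; rewrite ifT// inE/= in_itv/= u0/=; exact: le_trans tb.
  move=> ut; rewrite mul0r; case: ifP => [|_]; last by rewrite mul0r.
  rewrite inE/= in_itv/= => /andP[u0 _].
  rewrite /X increment_path_le0 ?mulr0// subr_le0.
  by move: ut; rewrite u0/= => /negP; rewrite -ltNge => /ltW.
by rewrite /X; ring.
Qed.

(** * Mean-square estimates and conclusion *)

Section mean_square_estimates.
Context d (T : measurableType d) (R : realType) (P : probability T R).
Variables (H : R) (B : R -> T -> R).
Hypotheses (H0 : 0 < H) (H1 : H < 1) (fB : fractional_brownian_motion P H B).

Let X := increment_path B.

Let cX w : continuous (X ^~ w).
Proof. exact/continuous_increment_path/(fbm_continuous fB). Qed.

Let mX t : measurable_fun setT (X t).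
Proof.
apply: measurable_funB; apply: (fbm_measurable fB) => //.
by rewrite le_max lexx orbT.
Qed.

Let mXX : measurable_fun [set: measurableTypeR R * T]
  (fun z : measurableTypeR R * T => X z.1 z.2).
Proof. exact: measurable_continuous_process mX cX. Qed.

Let mXr t : measurable_fun [set: measurableTypeR R * T]
  (fun z : measurableTypeR R * T => X (t - z.1) z.2).
Proof.
have mr : measurable_fun [set: measurableTypeR R * T]
    (fun z : measurableTypeR R * T => (t - z.1, z.2) : measurableTypeR R * T).
  by apply: measurable_fun_pair => //=; apply: measurable_funB.
exact: (measurableT_comp mXX mr).
Qed.

Let cXr t w : continuous (fun u => X (t - u) w).
Proof.
move=> u; apply: (@continuous_comp _ _ _ (fun u => t - u) (X ^~ w)); last exact: cX.
by apply: cvgB; [exact: cvg_cst|].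
Qed.

Lemma increment_path_second_moment s t :
  ('E_P[fun w => ((increment_path B t w - increment_path B s w) ^+ 2)%R] <=
   (`|t - s|%R `^ (2 * H))%:E)%E.
Proof.
rewrite (_ : (fun w => _) = (fun w => (B (Num.max t 0) w - B (Num.max s 0) w) ^+ 2)).
  rewrite (fbm_increment_second_moment H0 fB) ?le_max ?lexx ?orbT// lee_fin.
  by apply: ge0_ler_powR; rewrite ?nnegrE ?ler_dist_max0 ?normr_ge0 ?mulr_ge0 ?(ltW H0).
by apply/funext => w; rewrite /X /increment_path; congr (_ ^+ 2); ring.
Qed.

Let B0_mean_square : mean_square_le P (B 0) 0.
Proof.
apply: mean_square_le_measurable; first exact: (fbm_measurable fB).
by rewrite (fbm_second_moment H0 fB)// powR0// mulf_neq0// gt_eqF.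
Qed.

(** Since [q] has mass [1 - e], one has
[X t - int q(u) X (t - u) du = e * X t + int q(u) (X t - X (t - u)) du]. In the
first term the growth of [X t] is absorbed by [e]; in the second one the
increment over [u] is integrated against an exponential density. *)
Lemma fractional_OU_mean_square lambda t : 0 < lambda -> 0 <= t ->
  mean_square_le P (fractional_OU B lambda t) (96 * lambda `^ (- (2 * H))).
Proof.
move=> l0 t0.
have H2 : 0 <= 2 * H <= 2 by rewrite mulr_ge0 ?(ltW H0)//= ler_piMr // (ltW H1).
pose Y u w := X t w - X (t - u) w.
pose e := expR (- lambda * t).
set L := lambda `^ _.
have L0 : 0 <= L by exact: powR_ge0.
have ZE : fractional_OU B lambda t = (fun w => (e * X t w +
    \int[lebesgue_measure]_u (exp_weight lambda t u * Y u w)) + e * B 0 w).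
  apply/funext => w.
  rewrite (@fractional_OUE _ _ _ _ _ t) ?t0 ?lexx//; last exact: (fbm_continuous fB).
  congr (_ + _); rewrite -/X -/e.
  have iX : lebesgue_measure.-integrable setT
      (EFin \o (fun u => exp_weight lambda t u * X (t - u) w)).
    exact: integrable_exp_weightM.
  have iXt : lebesgue_measure.-integrable setT
      (EFin \o (fun u => exp_weight lambda t u * X t w)).
    by apply: integrable_exp_weightM => // u; exact: cvg_cst.
  under [in RHS]eq_Rintegral do rewrite /Y mulrBr.
  rewrite RintegralB//.
  have -> : \int[lebesgue_measure]_u (exp_weight lambda t u * X t w) = (1 - e) * X t w.
    rewrite RintegralZr//; first by rewrite /Rintegral integral_exp_weight.
    have -> : exp_weight lambda t = (fun u => exp_weight lambda t u * 1).
      by apply/funext => u; rewrite mulr1.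
    by apply: (@integrable_exp_weightM _ lambda t (cst 1)) => u; exact: cvg_cst.
  by ring.
rewrite ZE.
have A1 : mean_square_le P (fun w => e * X t w) (8 * L).
  apply: (@mean_square_leW _ _ _ _ _ (e ^+ 2 * t `^ (2 * H))).
    have := powR_le_expR_half l0 t0 H2; rewrite -/L => h.
    apply: (@le_trans _ _ (e ^+ 2 * (L * (8 * expR (lambda / 2 * t))))).
      by rewrite ler_wpM2l ?sqr_ge0.
    have : e ^+ 2 * expR (lambda / 2 * t) <= 1.
      rewrite /e expr2 -!expRD expR_le1.
      by have := mulr_ge0 (ltW l0) t0; lra.
    by move: (expR _) => x ?; nra.
  apply: mean_square_leZ; apply: mean_square_le_measurable => //.
  rewrite (_ : (fun w => _) = (fun w => (X t w - X 0 w) ^+ 2)); last first.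
    by apply/funext => w; rewrite [X 0 w]increment_path_le0// subr0.
  by have := increment_path_second_moment 0 t; rewrite subr0 ger0_norm.
have A2 : mean_square_le P
    (fun w => \int[lebesgue_measure]_u (exp_weight lambda t u * Y u w)) (16 * L).
  apply: (@mean_square_le_average _ _ _ _ _ (measurableTypeR R) lebesgue_measure
    _ (fun u : R => L * (8 * expR (lambda / 2 * u))) Y).
  - by move=> u; exact: exp_weight_ge0.
  - exact: measurable_exp_weight.
  - exact: integral_exp_weight_le1.
  - apply: measurable_funB; last exact: mXr.
    exact: (measurableT_comp (mX t) measurable_snd).
  - move=> w; apply: integrable_exp_weightM => // u.
    by apply: cvgB; [exact: cvg_cst|exact: cXr].
  - move=> u /exp_weight_gt0/andP[u0 _].
    apply: le_trans (increment_path_second_moment (t - u) t) _.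
    by rewrite subKr ger0_norm// lee_fin powR_le_expR_half.
  - apply: measurable_funM => //; apply: measurable_funM => //.
    by apply: continuous_measurable_fun; exact: continuous_expR_linear.
  - rewrite (_ : (fun u => _) = (fun u => (8 * L)%:E *
      (exp_weight lambda t u * expR (lambda / 2 * u))%:E)%E); last first.
      by apply/funext => u; rewrite -EFinM; congr EFin; ring.
    rewrite ge0_integralZl//.
    + apply: (@le_trans _ _ ((8 * L)%:E * 2%:E)%E).
        by rewrite lee_wpmul2l ?integral_exp_weight_expR_half// lee_fin mulr_ge0.
      by rewrite -EFinM lee_fin; lra.
    + apply/measurable_EFinP; apply: measurable_funM; first exact: measurable_exp_weight.
      by apply: continuous_measurable_fun; exact: continuous_expR_linear.
    + by move=> u _; rewrite lee_fin mulr_ge0 ?expR_ge0 ?exp_weight_ge0.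
    + by rewrite lee_fin mulr_ge0.
apply: mean_square_leW (mean_square_leD (mean_square_leD A1 A2)
  (mean_square_leZ e B0_mean_square)).
by rewrite mulr0; lra.
Qed.

(** Both [X t2 - X t1] and the average of [X (t2 - u) - X (t1 - u)] involve only
increments over the length [t2 - t1], so [lambda] does not appear. *)
Lemma fractional_OU_increment_mean_square lambda t1 t2 :
  0 < lambda -> 0 <= t1 -> t1 <= t2 ->
  mean_square_le P
    (fun w => fractional_OU B lambda t2 w - fractional_OU B lambda t1 w)
    (8 * (t2 - t1) `^ (2 * H)).
Proof.
move=> l0 t10 t12; have t20 := le_trans t10 t12.
pose Y u w := X (t2 - u) w - X (t1 - u) w.
pose c := expR (- lambda * t2) - expR (- lambda * t1).
set h := (t2 - t1) `^ _.
have h0 : 0 <= h by exact: powR_ge0.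
have Xh u : ('E_P[fun w => ((X (t2 - u) w - X (t1 - u) w) ^+ 2)%R] <= h%:E)%E.
  have := increment_path_second_moment (t1 - u) (t2 - u).
  by rewrite (_ : t2 - u - (t1 - u) = t2 - t1) ?ger0_norm ?subr_ge0//; ring.
have ZE : (fun w => fractional_OU B lambda t2 w - fractional_OU B lambda t1 w) =
  (fun w => ((X t2 w - X t1 w) + -1 *
    \int[lebesgue_measure]_u (exp_weight lambda t2 u * Y u w)) + c * B 0 w).
  apply/funext => w.
  rewrite !(@fractional_OUE _ _ _ _ _ t2) ?t10 ?t20 ?lexx//; try exact: (fbm_continuous fB).
  under [in RHS]eq_Rintegral do rewrite /Y mulrBr.
  rewrite RintegralB//; try exact: integrable_exp_weightM.
  by rewrite /c /X; ring.
rewrite ZE.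
have A1 : mean_square_le P (fun w => X t2 w - X t1 w) h.
  apply: mean_square_le_measurable; first exact: measurable_funB.
  by have := Xh 0; rewrite !subr0.
have A2 : mean_square_le P
    (fun w => \int[lebesgue_measure]_u (exp_weight lambda t2 u * Y u w)) h.
  apply: (@mean_square_le_average _ _ _ _ _ (measurableTypeR R) lebesgue_measure
    _ (fun=> h) Y).
  - by move=> u; exact: exp_weight_ge0.
  - exact: measurable_exp_weight.
  - exact: integral_exp_weight_le1.
  - by apply: measurable_funB; exact: mXr.
  - move=> w; apply: integrable_exp_weightM => // u.
    by apply: cvgB; exact: cXr.
  - by move=> u _; exact: Xh.
  - exact: measurable_cst.
  - rewrite (_ : (fun u => _) = (fun u => h%:E * (exp_weight lambda t2 u)%:E)%E); last first.
      by apply/funext => u; rewrite -EFinM mulrC.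
    rewrite ge0_integralZl//.
    + by rewrite -[leRHS]mule1 lee_wpmul2l ?integral_exp_weight_le1.
    + by apply/measurable_EFinP; exact: measurable_exp_weight.
    + by move=> u _; rewrite lee_fin exp_weight_ge0.
apply: mean_square_leW (mean_square_leD (mean_square_leD A1 (mean_square_leZ (-1) A2))
  (mean_square_leZ c B0_mean_square)).
by rewrite mulr0; lra.
Qed.

End mean_square_estimates.

(** Put [y = lambda * h]. If [1 <= y], the first term of the minimum is at most its
product with [y ^ a]; if [y < 1], the second one is [lambda ^ (- b) * y ^ b], and
[y ^ b <= y ^ a]. *)
Lemma powR_interpolation (R : realType) (lambda h a b K1 K2 : R) :
  0 < lambda -> 0 <= h -> 0 <= a <= b -> 0 < b -> 0 <= K1 -> 0 <= K2 ->
  Num.min (K1 * lambda `^ (- b)) (K2 * h `^ b) <=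
    (K1 + K2) * lambda `^ (a - b) * h `^ a.
Proof.
move=> l0 h0 /andP[a0 ab] b0 K10 K20; rewrite ge_min; apply/orP.
have ll : 0 <= lambda by exact: ltW.
have -> : (K1 + K2) * lambda `^ (a - b) * h `^ a =
    (K1 + K2) * (lambda `^ (- b) * (lambda * h) `^ a).
  rewrite powRM// -mulrA [in RHS](mulrA (lambda `^ (- b))) -powRD.
    by rewrite (addrC (- b)).
  by rewrite lt0r_neq0 ?implybT.
have L0 : 0 <= lambda `^ (- b) by exact: powR_ge0.
have [y1|y1] := leP 1 (lambda * h).
  left; apply: ler_pM => //; first by rewrite lerDl.
  rewrite ler_peMr//; have := @ge0_ler_powR R a a0 1 (lambda * h).
  by rewrite powR1; apply; rewrite ?nnegrE ?mulr_ge0.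
right.
have -> : h `^ b = lambda `^ (- b) * (lambda * h) `^ b.
  rewrite powRM// mulrA -powRD; last by rewrite lt0r_neq0 ?implybT.
  by rewrite addNr powRr0 mul1r.
apply: ler_pM => //; first by rewrite mulr_ge0 ?powR_ge0.
  by rewrite lerDr.
rewrite ler_wpM2l//.
have [->|hn0] := eqVneq h 0; first by rewrite mulr0 powR0 ?gt_eqF// powR_ge0.
have hp : 0 < h by rewrite lt0r hn0.
by apply: ger_powR => //; rewrite mulr_gt0//= ltW.
Qed.

Set Strict Implicit.
Unset Implicit Arguments.

Theorem lemmaB2 (R : realType) (H alpha : R) :
  1 / 2 < H < 1 -> 0 <= alpha <= 2 * H ->
  exists C : R, 0 < C /\
    forall (d : measure_display) (T : measurableType d) (P : probability T R)
      (B : R -> T -> R), fractional_brownian_motion P H B ->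
    forall lambda t1 t2 : R, 0 < lambda -> 0 <= t1 -> 0 <= t2 ->
      ('E_P[fun w =>
          (`|fractional_OU B lambda t2 w - fractional_OU B lambda t1 w| ^+ 2)%R]
        <= (C * lambda `^ (alpha - 2 * H) * `|t2 - t1| `^ alpha)%:E)%E.
Proof.
move=> /andP[H12 H1] a2H.
have H0 : 0 < H by lra.
(* 384 = 2 * (96 + 96) from the uniform bound at the two times, plus 8 from the
   increment bound *)
exists 392; split=> [|d T P B fB lambda t1 t2]; first by rewrite ltr0n.
wlog t12 : t1 t2 / t1 <= t2 => [hw l0 t10 t20|l0 t10 t20].
  have [t12|/ltW t21] := leP t1 t2; first exact: hw.
  by rewrite distrC expectation_sqr_distC; exact: hw.
have D2 := fractional_OU_increment_mean_square H0 fB l0 t10 t12.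
have D1 : mean_square_le P
    (fun w => fractional_OU B lambda t2 w - fractional_OU B lambda t1 w)
    (384 * lambda `^ (- (2 * H))).
  rewrite (_ : (fun w => _) =
    (fun w => fractional_OU B lambda t2 w + -1 * fractional_OU B lambda t1 w)); last first.
    by apply/funext => w; rewrite mulN1r.
  apply: mean_square_leW (mean_square_leD (fractional_OU_mean_square H0 H1 fB l0 t20)
    (mean_square_leZ (-1) (fractional_OU_mean_square H0 H1 fB l0 t10))).
  lra.
rewrite ger0_norm ?subr_ge0//.
have H2 : 0 < 2 * H by lra.
have K1 : 0 <= 384 :> R by rewrite ler0n.
have K2 : 0 <= 8 :> R by rewrite ler0n.
have h0 : 0 <= t2 - t1 by rewrite subr_ge0.
have := powR_interpolation l0 h0 a2H H2 K1 K2.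
rewrite (_ : 384 + 8 = 392); last by ring.
rewrite -lee_fin; apply: le_trans.
by rewrite EFin_min le_min !expectation_mean_square_le.
Qed.
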